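(* Let $r$ and $k$ be fixed nonnegative integers. Then, as $n\to\infty$, the number of $132$-avoiding permutations of $\{1,2,\dots,n\}$ with exactly $r$ occurrences of the pattern $12\dots k$ equals $$\left(\frac{4\sin^2\frac{\pi}{k+1}}{k+1}\right)^{r+1}\frac{n^r}{r!}\left(4\cos^2\frac{\pi}{k+1}\right)^{n-r}\left(1+O\left(\frac1n\right)\right).$$
   Context: For a permutation $\pi=\pi_1\cdots\pi_n$ of $\{1,\dots,n\}$ and a permutation $\sigma=\sigma_1\cdots\sigma_m$ of $\{1,\dots,m\}$, an occurrence of the pattern $\sigma$ in $\pi$ is a choice of indices $i_1<\dots<i_m$ such that $\pi_{i_1}\cdots\pi_{i_m}$ is in the same relative order as $\sigma$; $\pi$ is $\sigma$-avoiding if there is no occurrence. Here $\pi$ in $\sin$ and $\cos$ denotes the number $3.14159\ldots$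
   Formalization: The pair k = 0, r = 1 is excluded: the empty pattern occurs exactly once in every permutation, so the count is the Catalan number, while sin(π) = 0 makes the stated formula 0; all other nonnegative r and k are covered. *)

(* Defs.v *)
From mathcomp Require Import all_boot all_fingroup.

Set Implicit Arguments.
Unset Strict Implicit.
Unset Printing Implicit Defensive.

(* A permutation of {1, ..., n} is an element of 'S_n: positions and values   *)
(* are shifted down by one.                                                   *)

(* The index choice i_1 < ... < i_m is encoded as a strictly increasing map f. *)
Definition occurrence (m n : nat) (s : 'S_m) (p : 'S_n)
    (f : {ffun 'I_m -> 'I_n}) : bool :=
  [forall a : 'I_m, forall b : 'I_m, (a < b) ==> (f a < f b)] &&
  [forall a : 'I_m, forall b : 'I_m, (p (f a) < p (f b)) == (s a < s b)].

Definition occurrences (m n : nat) (s : 'S_m) (p : 'S_n) : nat :=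
  #|[set f : {ffun 'I_m -> 'I_n} | occurrence s p f]|.

Definition avoids (m n : nat) (s : 'S_m) (p : 'S_n) : bool :=
  ~~ [exists f : {ffun 'I_m -> 'I_n}, occurrence s p f].

Definition pattern132 : 'S_3 :=
  tperm (@Ordinal 3 1 isT) (@Ordinal 3 2 isT).

Definition pattern_id (k : nat) : 'S_k := 1%g.

Definition num_av132 (n k r : nat) : nat :=
  #|[set p : 'S_n | avoids pattern132 p & occurrences (pattern_id k) p == r]|.

(* Main.v *)
Require Import Defs.
From mathcomp Require Import all_boot all_order all_algebra all_fingroup.
From mathcomp Require Import all_classical all_reals all_analysis.
From mathcomp Require Import zify ring lra.
Import Order.TTheory GRing.Theory Num.Theory.
Import numFieldNormedType.Exports.

Set Implicit Arguments.
Unset Strict Implicit.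
Unset Printing Implicit Defensive.

(** Let h_i be one more than the number of entries to the right of and larger
    than the i-th entry of a 132-avoiding permutation. These larger entries are
    increasing, so the number of occurrences of 12...k is the sum of the
    'C(h_i - 1, k-1), and the sequences h that arise are those whose last term
    is 1 and in which 1 <= h_i <= h_(i+1) + 1. Read from right to left they
    describe Dyck paths of length 2n, so one counts Dyck paths in which an up
    step from height h costs 'C(h, k-1), by total cost r.

    Cost-free paths stay in the strip of heights 0 .. k-1, where the step
    operator has eigenvectors sin(j pi (h+1)/(k+1)) and eigenvalues
    2 cos(j pi/(k+1)). Taking the sine transform of the path counts decouples
    them into scalar recurrences whose source term is the count of paths of
    cost r ending at height k, which come from the paths of cost r-1 ending at
    height k-1 up to lower order terms. By induction on r, the modes j = 1 and
    j = k, which are equal up to the sign (-1)^N, grow like a constant times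
    N^r (2 cos(pi/(k+1)))^N, and everything else is smaller by a factor O(1/N). *)

(** * Occurrences of increasing patterns *)

Lemma avoids132P n (p : 'S_n) :
  reflect (forall i j l : 'I_n, i < j -> j < l -> p i < p l -> p l < p j -> False)
          (avoids pattern132 p).
Proof.
have p0 (h : 0 < 3) : pattern132 (Ordinal h) = 0 :> nat by rewrite permE.
have p1 (h : 1 < 3) : pattern132 (Ordinal h) = 2 :> nat by rewrite permE.
have p2 (h : 2 < 3) : pattern132 (Ordinal h) = 1 :> nat by rewrite permE.
apply: (iffP idP) => [/existsP no_occ i j l ij jl il lj|no132].
  case: no_occ; exists [ffun a : 'I_3 => tnth [tuple i; j; l] a].
  apply/andP; split; apply/forallP => -[[|[|[|//]]] ha];
    apply/forallP => -[[|[|[|//]]] hb]; rewrite !ffunE /tnth /= ?p0 ?p1 ?p2; lia.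
apply/existsP => -[f /andP[/forallP inc /forallP same_order]].
have f_lt (a b : 'I_3) : a < b -> f a < f b by move/forallP/(_ b)/implyP: (inc a).
have pf_lt (a b : 'I_3) : (p (f a) < p (f b)) = (pattern132 a < pattern132 b).
  by move/forallP/(_ b)/eqP: (same_order a).
pose o i h : 'I_3 := @Ordinal 3 i h.
apply: (no132 (f (o 0 isT)) (f (o 1 isT)) (f (o 2 isT)));
  rewrite ?pf_lt ?p0 ?p1 ?p2 //; exact: f_lt.
Qed.

Definition increasing_on n (p : 'S_n) (A : {set 'I_n}) : bool :=
  [forall i in A, forall j in A, (i < j) ==> (p i < p j)].

Lemma increasing_onP n (p : 'S_n) (A : {set 'I_n}) :
  reflect {in A &, {homo p : i j / i < j}} (increasing_on p A).
Proof.
apply: (iffP forall_inP) => [inc i j Ai Aj ij|inc i Ai].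
  by have /forall_inP/(_ j Aj)/implyP := inc i Ai; apply.
by apply/forall_inP => j Aj; apply/implyP; apply: inc.
Qed.

Lemma mono_imset_inj d d' (T : finPOrderType d) (T' : finPOrderType d') (f g : T -> T') :
  total (<=%O : rel T) -> {mono f : x y / (x <= y)%O} -> {mono g : x y / (x <= y)%O} ->
  f @: T = g @: T -> f =1 g.
Proof.
move=> le_total f_mono g_mono fg x.
have uniq_map (h : T -> T') : {mono h : x y / (x <= y)%O} -> uniq (map h (Order.enum T)).
  by move=> h_mono; rewrite map_inj_uniq ?Order.enum_uniq //; exact: inc_inj.
suff /eq_in_map/(_ x) -> : map f (Order.enum T) = map g (Order.enum T) by rewrite ?Order.mem_enum.
apply: le_sorted_eq; rewrite ?Order.mono_sorted_enum //.
apply: uniq_perm; rewrite ?uniq_map // => y.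
have mem_map (h : T -> T') : (y \in map h (Order.enum T)) = (y \in h @: T).
  by apply/mapP/imsetP => -[z _ ->]; exists z; rewrite ?Order.mem_enum.
by rewrite !mem_map fg.
Qed.

Lemma occurrence_idP k n (p : 'S_n) (f : {ffun 'I_k -> 'I_n}) :
  reflect ({mono f : a b / (a <= b)%O} /\ increasing_on p (f @: 'I_k))
          (occurrence (pattern_id k) p f).
Proof.
apply: (iffP andP) => [[/forallP f_inc /forallP pf_inc]|[f_mono /increasing_onP p_inc]].
  have f_mono : {mono f : a b / (a <= b)%O}.
    by apply: le_mono => a b ab; have /forallP/(_ b)/implyP := f_inc a; apply.
  split=> //; apply/increasing_onP => _ _ /imsetP[a _ ->] /imsetP[b _ ->].
  have /forallP/(_ b)/eqP -> := pf_inc a; rewrite !perm1.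
  by have := leW_mono f_mono a b; rewrite !ltEord => ->.
have f_lt (a b : 'I_k) : (f a < f b) = (a < b) by have := leW_mono f_mono a b; rewrite !ltEord.
have fI (a : 'I_k) : f a \in f @: 'I_k by apply: imset_f.
split; apply/forallP => a; apply/forallP => b; first by rewrite f_lt implybb.
rewrite !perm1; case: (ltngtP a b) => ab; first by rewrite p_inc ?f_lt.
  by apply/eqP/negbTE; rewrite -leqNgt ltnW // p_inc ?f_lt.
by rewrite (val_inj ab) ltnn.
Qed.

Lemma occurrences_id k n (p : 'S_n) :
  occurrences (pattern_id k) p =
  #|[set A : {set 'I_n} | (#|A| == k) && increasing_on p A]|.
Proof.
have ord_total m : total (<=%O : rel 'I_m) by move=> a b; rewrite !leEord leq_total.
have im_inj : {in [set f : {ffun 'I_k -> 'I_n} | occurrence (pattern_id k) p f] &,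
    injective (fun f : {ffun 'I_k -> 'I_n} => f @: 'I_k)}.
  move=> f g; rewrite !inE => /occurrence_idP[f_mono _] /occurrence_idP[g_mono _] fg.
  apply/ffunP; exact: (mono_imset_inj (ord_total k)).
rewrite /occurrences -(card_in_imset im_inj); apply: eq_card => A.
rewrite [in RHS]inE; apply/imsetP/andP => [[f]|[/eqP cardA p_inc]].
  rewrite inE => /occurrence_idP[f_mono p_inc] ->; split=> //.
  by rewrite card_imset ?card_ord //; apply: inc_inj.
subst k; pose f := [ffun a => @Order.enum_val _ _ A a].
have f_mono : {mono f : a b / (a <= b)%O}.
  by move=> a b; rewrite !ffunE Order.le_enum_val //; apply: ord_total.
have fA : f @: 'I_#|A| = A.
  apply/eqP; rewrite eqEcard card_imset ?card_ord ?leqnn ?andbT; last exact: inc_inj.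
  by apply/fintype.subsetP => _ /imsetP[a _ ->]; rewrite ffunE Order.enum_valP.
by exists f; rewrite ?fA // inE; apply/occurrence_idP; rewrite fA.
Qed.

Lemma occurrences_id_le1 k n (p : 'S_n) : k <= 1 -> occurrences (pattern_id k) p = 'C(n, k).
Proof.
move=> k1; rewrite occurrences_id -[n in RHS]card_ord -cardsT -cards_draws.
apply: eq_card => A; rewrite !inE finset.subsetT; apply/andb_idr => /eqP cardA.
have /card_le1_eqP A1 : #|A| <= 1 by rewrite cardA.
by apply/increasing_onP => i j Ai Aj; rewrite (A1 i j) ?ltnn.
Qed.

(** * Prepending an entry *)

Lemma ord_lift_ind n (P : 'I_n.+1 -> Prop) :
  P ord0 -> (forall i, P (lift ord0 i)) -> forall i, P i.
Proof. by move=> P0 PS i; case: (unliftP ord0 i) => [j|] ->. Qed.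

Lemma ltn_lift n (v : 'I_n.+1) (a b : 'I_n) : (lift v a < lift v b) = (a < b).
Proof. by rewrite /= ltnNge leq_bump2 -ltnNge. Qed.

Lemma ltn_lift_self n (v : 'I_n.+1) (a : 'I_n) : (v < lift v a) = (v <= a).
Proof. by rewrite /= /bump; lia. Qed.

Lemma notin_imset_lift n (v : 'I_n.+1) (B : {set 'I_n}) : v \notin lift v @: B.
Proof. by apply/imsetP => -[j _ /eqP]; rewrite (negbTE (neq_lift _ _)). Qed.

Lemma card_ord_geq n m : #|[set j : 'I_n | m <= j]| = n - m.
Proof.
rewrite -sum1dep_card; elim: n => [|n IH]; first by rewrite big_ord0.
by rewrite big_mkcond big_ord_recr -big_mkcond IH /=; case: ifP; lia.
Qed.

Lemma card_set_ordS n (P : pred {set 'I_n.+1}) :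
  #|[set A | P A]| = #|[set B : {set 'I_n} | P (lift ord0 @: B)]| +
                     #|[set B : {set 'I_n} | P (ord0 |: lift ord0 @: B)]|.
Proof.
pose f (bB : bool * {set 'I_n}) := (if bB.1 then [set ord0] else finset.set0) :|: lift ord0 @: bB.2.
have f_ord0 bB : (ord0 \in f bB) = bB.1.
  by rewrite inE (negbTE (notin_imset_lift _ _)); case: bB.1; rewrite !inE ?eqxx.
have f_lift bB i : (lift ord0 i \in f bB) = (i \in bB.2).
  rewrite !inE mem_imset; last exact: lift_inj.
  by case: bB.1; rewrite !inE ?[_ == ord0]eq_sym ?(negbTE (neq_lift _ _)).
have f_bij : bijective f.
  apply: inj_card_bij => [[b B] [b' B'] /setP e|].
    congr pair; first by have := e ord0; rewrite !f_ord0.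
    by apply/setP => i; have := e (lift ord0 i); rewrite !f_lift.
  by rewrite card_prod card_bool -!cardsT -!powersetT !card_powerset !cardsT !card_ord expnS.
rewrite -!sum1dep_card [LHS]big_mkcond (reindex f) /=; last exact: onW_bij.
rewrite -(pair_bigA _ (fun b B => if P (f (b, B)) then 1 else 0)) big_bool /= -!big_mkcond addnC.
by congr addn; apply: eq_bigl => B; rewrite /f finset.set0U.
Qed.

Section Prepend.
Variables (n : nat) (v : 'I_n.+1).
Implicit Type p : 'S_n.
Local Notation prepend := (lift_perm ord0 v).

Lemma card_prepend (P : pred 'S_n.+1) :
  #|[set q : 'S_n.+1 | (q ord0 == v) && P q]| = #|[set p | P (prepend p)]|.
Proof.
pose f (vp : 'I_n.+1 * 'S_n) := lift_perm ord0 vp.1 vp.2.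
have f_inj : injective f.
  move=> [w p] [w' p'] /permP /= e; have := e ord0; rewrite !lift_perm_id /= => w_eq.
  move: e; rewrite -{}w_eq => e; congr pair; apply/permP => i.
  by have := e (lift ord0 i); rewrite !lift_perm_lift => /lift_inj.
have [g _ gK] : bijective f.
  by apply: inj_card_bij => //; rewrite card_prod !card_Sn card_ord factS.
have prepend_inj : injective prepend by move=> p p' /(f_inj (v, p) (v, p'))[].
rewrite -[RHS](card_imset _ prepend_inj); apply: eq_card => q; rewrite inE.
apply/andP/imsetP => [[/eqP q0 Pq]|[p]]; last first.
  by rewrite inE => Pp ->; rewrite lift_perm_id.
have g1 : (g q).1 = v by rewrite -q0 -[in RHS](gK q) lift_perm_id.
have qE : q = prepend (g q).2 by rewrite -g1 [RHS]gK.
by exists (g q).2; rewrite ?inE -?qE.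
Qed.

Lemma avoids_prependP p :
  reflect (avoids pattern132 p /\
           forall j l : 'I_n, j < l -> v <= p l -> p j < p l)
          (avoids pattern132 (prepend p)).
Proof.
apply: (iffP (avoids132P _)) => [av|[/avoids132P av above_inc]].
  split; first apply/avoids132P => i j l ij jl il lj.
    by apply: (av (lift ord0 i) (lift ord0 j) (lift ord0 l));
      rewrite ?lift_perm_lift ?ltn_lift.
  move=> j l jl vl; rewrite ltnNge leq_eqVlt; apply/negP => /orP[/eqP|] plj.
    by move: jl; rewrite (perm_inj (val_inj plj)) ltnn.
  by apply: (av ord0 (lift ord0 j) (lift ord0 l));
    rewrite ?lift_perm_lift ?lift_perm_id ?ltn_lift ?ltn_lift_self.
elim/ord_lift_ind => [|i]; elim/ord_lift_ind => [//|j]; elim/ord_lift_ind => [//|l];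
  rewrite ?lift_perm_lift ?lift_perm_id ?ltn_lift ?ltn_lift_self.
  by move=> _ jl /(above_inc j l jl) plj; rewrite ltnNge ltnW.
exact: av.
Qed.

Lemma increasing_on_prepend_lift p (B : {set 'I_n}) :
  increasing_on (prepend p) (lift ord0 @: B) = increasing_on p B.
Proof.
apply/increasing_onP/increasing_onP => [inc i j Bi Bj|inc].
  have := inc _ _ (imset_f (lift ord0) Bi) (imset_f (lift ord0) Bj).
  by rewrite !lift_perm_lift !ltn_lift.
by move=> _ _ /imsetP[i Bi ->] /imsetP[j Bj ->]; rewrite !lift_perm_lift !ltn_lift; apply: inc.
Qed.

(* In a 132-avoiding permutation the entries exceeding the first one increase. *)
Lemma increasing_on_prepend0 p (B : {set 'I_n}) : avoids pattern132 (prepend p) ->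
  increasing_on (prepend p) (ord0 |: lift ord0 @: B) = (B \subset [set i | v <= p i]).
Proof.
move=> /avoids_prependP[_ above_inc]; apply/increasing_onP/fintype.subsetP => [inc i Bi|B_above].
  have := inc ord0 (lift ord0 i) (setU11 _ _) (setU1r _ (imset_f _ Bi)) isT.
  by rewrite lift_perm_lift lift_perm_id ltn_lift_self inE.
move=> i j /finset.setU1P[->|/imsetP[i' Bi ->]] /finset.setU1P[->|/imsetP[j' Bj ->]] //;
  have := B_above _ Bj; rewrite inE => above.
  by move=> _; rewrite lift_perm_lift lift_perm_id ltn_lift_self.
by rewrite !lift_perm_lift !ltn_lift => ij; apply: above_inc.
Qed.

Lemma occurrences_prepend p K : avoids pattern132 (prepend p) ->
  occurrences (pattern_id K.+1) (prepend p) =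
  occurrences (pattern_id K.+1) p + 'C(n - v, K).
Proof.
move=> av; rewrite !occurrences_id card_set_ordS.
have card_lift (B : {set 'I_n}) : #|lift ord0 @: B| = #|B| by apply/card_imset/lift_inj.
congr addn; first by apply: eq_card => B; rewrite !inE card_lift increasing_on_prepend_lift.
have <- : #|[set i | v <= p i]| = n - v.
  rewrite -card_ord_geq -[RHS](card_preimset _ (@perm_inj _ p)).
  by apply: eq_card => i; rewrite !inE.
rewrite -cards_draws; apply: eq_card => B; rewrite !inE increasing_on_prepend0 // andbC.
by rewrite cardsU1 card_lift notin_imset_lift.
Qed.

End Prepend.

(* One more than the number of entries exceeding the first one, or 0 if there is
   no first one. *)
Definition head_height n : 'S_n -> nat :=
  if n is n'.+1 then fun p => n'.+1 - p ord0 else fun=> 0.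

Lemma head_height_le n (p : 'S_n) : head_height p <= n.
Proof. by case: n p => //= n p; rewrite leq_subr. Qed.

Lemma avoids_prepend n (v : 'I_n.+1) (p : 'S_n) :
  avoids pattern132 (lift_perm ord0 v p) =
  avoids pattern132 p && (n - v <= head_height p).
Proof.
apply/avoids_prependP/andP => -[av].
  move=> above_inc; split=> //; case: n v p av above_inc => [|n] v p av above_inc.
    by rewrite sub0n.
  rewrite leq_sub2l // leqNgt; apply/negP => vp.
  have ltp : (p ord0).-1 < n.+1 by have := ltn_ord (p ord0); lia.
  set l := (p^-1 (Ordinal ltp))%g; have pl : p l = (p ord0).-1 :> nat by rewrite permKV.
  have l0 : (ord0 : 'I_n.+1) < l.
    rewrite lt0n; apply/eqP => l0; move: pl; rewrite (_ : l = ord0); last exact: val_inj.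
    by lia.
  by have := above_inc ord0 l l0; rewrite pl; lia.
move=> v_high; split=> //; case: n v p av v_high => [|n] v p /avoids132P av v_high j l jl vl.
  by case: j jl.
have p0v : p ord0 <= v by move: v_high (ltn_ord (p ord0)) (ltn_ord v); rewrite /=; lia.
have p_neq (a b : 'I_n.+1) : a < b -> p a != p b :> nat.
  by move=> ab; apply/eqP => /val_inj/perm_inj e; move: ab; rewrite e ltnn.
rewrite ltn_neqAle p_neq //= leqNgt; apply/negP => lj.
case: (posnP j) => [j0|j0].
  by move: lj; rewrite (_ : j = ord0) ?(leq_gtF (leq_trans p0v vl)) //; apply: val_inj.
have l0 : (ord0 : 'I_n.+1) < l by apply: leq_trans jl.
by apply: (av ord0 j l) => //; rewrite ltn_neqAle p_neq //= (leq_trans p0v).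
Qed.

(** * From permutations to lattice paths *)

(* The number of lattice paths of N unit steps from height 0 to height h with
   total cost r, where an up step from height i costs 'C(i, K). *)
Fixpoint npaths (K N r h : nat) : nat :=
  if N is N'.+1 then
    npaths K N' r h.+1 +
    (if h is i.+1 then if 'C(i, K) <= r then npaths K N' (r - 'C(i, K)) i else 0 else 0)
  else (r == 0) && (h == 0).

Definition num_av132_high K n r i : nat :=
  #|[set p : 'S_n | [&& avoids pattern132 p, occurrences (pattern_id K.+1) p == r &
                        i <= head_height p]]|.

Lemma num_av132_high0 K n r : num_av132_high K n r 0 = num_av132 n K.+1 r.
Proof. by apply: eq_card => p; rewrite !inE andbT. Qed.

Lemma num_av132_high_gt K n r i : n < i -> num_av132_high K n r i = 0.
Proof.
move=> ni; apply/eqP; rewrite cards_eq0; apply/eqP/setP => p; rewrite !inE.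
by rewrite (leqNgt i) (leq_ltn_trans (head_height_le p) ni) !andbF.
Qed.

Lemma num_av132_high00 K r : num_av132_high K 0 r 0 = (r == 0).
Proof.
suff memE (p : 'S_0) :
    (p \in [set q | avoids pattern132 q & occurrences (pattern_id K.+1) q == r]) = (r == 0).
  by rewrite num_av132_high0 /num_av132; case: (r == 0) memE => /= [/eq_cardT->|/eq_card0//];
    rewrite -cardT card_Sn.
rewrite inE; have -> : avoids pattern132 p by apply/avoids132P => -[].
have -> : occurrences (pattern_id K.+1) p = 0.
  by apply/eqP; rewrite cards_eq0; apply/eqP/setP => f; case: (f ord0).
by rewrite eq_sym.
Qed.

Lemma num_av132_highS0 K n r : num_av132_high K n.+1 r 0 = num_av132_high K n.+1 r 1.
Proof. by apply: eq_card => p; rewrite !inE /= subn_gt0 ltn_ord. Qed.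

Lemma num_av132_highSS K n r i :
  num_av132_high K n.+1 r i.+1 = num_av132_high K n.+1 r i.+2 +
    (if 'C(i, K) <= r then num_av132_high K n (r - 'C(i, K)) i else 0).
Proof.
case: (ltnP n i) => [ni|i_le].
  by rewrite !num_av132_high_gt ?if_same // ltnW.
rewrite -[LHS](cardsID [set p | i.+1 < head_height p]); congr addn.
  by apply: eq_card => p; rewrite !inE -!andbA; do 2 congr andb; lia.
pose v : 'I_n.+1 := rev_ord (inord i).
have vE : n - v = i by rewrite /= inordK // subSS subKn.
transitivity #|[set q : 'S_n.+1 | (q ord0 == v) &&
    (avoids pattern132 q && (occurrences (pattern_id K.+1) q == r))]|.
  apply: eq_card => q; rewrite !inE -val_eqE /= inordK //.
  have := ltn_ord (q ord0); lia.
rewrite card_prepend; case: ifP => Cr; last first.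
  apply/eqP; rewrite cards_eq0; apply/eqP/setP => p; rewrite !inE.
  by apply/andP => -[av]; rewrite occurrences_prepend // vE; lia.
apply: eq_card => p; rewrite !inE avoids_prepend vE -andbA.
case: (boolP (avoids _ _)) => //= av; case: leqP => //= i_high; rewrite ?andbF ?andbT //.
by rewrite occurrences_prepend ?avoids_prepend ?av ?vE //; lia.
Qed.

(* The path is read off the permutation from right to left: prepending an entry
   smaller than exactly i others goes down from the current height to height i
   and then up. *)
Lemma num_av132_high_npaths K m n r i :
  m + i = n.*2 -> num_av132_high K n r i = npaths K m r i.
Proof.
elim: m n r i => [|m IH] [|n] r i //=.
- by case: i => //= _; rewrite num_av132_high00 andbT.
- case: i => // i iE; rewrite num_av132_high_gt ?andbF //; lia.
case: i => [|i] mi; first by rewrite num_av132_highS0 addn0 IH //; lia.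
by rewrite num_av132_highSS IH; [congr addn; case: ifP => // _; apply: IH; lia|lia].
Qed.

Lemma num_av132_npaths K n r : num_av132 n K.+1 r = npaths K n.*2 r 0.
Proof. by rewrite -num_av132_high0; apply: num_av132_high_npaths; rewrite addn0. Qed.

Local Open Scope classical_set_scope.
Local Open Scope ring_scope.

(** * Error terms *)

Section SequenceBigO.
Variable R : realFieldType.
Implicit Types f g e : nat -> R.

Lemma eq_bigO f g e : f =1 g -> f =O_\oo e -> g =O_\oo e.
Proof. by move/funext->. Qed.

Lemma near_eq_bigO f g e :
  (\forall n \near \oo, f n = g n) -> f =O_\oo e -> g =O_\oo e.
Proof.
move=> fg /eqO_exP[C C0 fC]; apply/eqO_exP; exists C => //.
by apply: filterS2 fg fC => n ->.
Qed.

(* A positive scale absorbs the finitely many terms ignored by [\oo]. *)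
Lemma bigO_seqP f e : (forall N, 0 < e N) ->
  f =O_\oo e <-> exists2 C, 0 <= C & forall N, `|f N| <= C * e N.
Proof.
move=> e_gt0; split=> [/eqO_exP[C C0 [n _ fC]]|[C C0 fC]]; last first.
  apply/eqO_exP; exists (C + 1); first by rewrite ltr_wpDl.
  apply: nearW => N; apply: le_trans (fC N) _.
  by rewrite (gtr0_norm (e_gt0 N)) ler_wpM2r ?(ltW (e_gt0 N)) // lerDl.
have ratio_ge0 i : 0 <= `|f i| / e i by rewrite divr_ge0 // ltW.
exists (C + \sum_(i < n) `|f i| / e i) => [|N]; first by rewrite addr_ge0 ?(ltW C0) // sumr_ge0.
rewrite -ler_pdivrMr //.
have [nN|Nn] := leqP n N.
  rewrite (@le_trans _ _ C) ?lerDl ?sumr_ge0 // ler_pdivrMr //.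
  by have := fC N nN; rewrite (gtr0_norm (e_gt0 N)).
rewrite (bigD1 (Ordinal Nn)) //= addrCA lerDl.
by rewrite addr_ge0 ?(ltW C0) // sumr_ge0.
Qed.

Lemma bigO_cst0 e : (fun=> 0 : R) =O_\oo e.
Proof. by apply/eqO_exP; exists 1 => //; apply: nearW => N; rewrite normr0 mul1r. Qed.

Lemma bigO_mul_bounded C b f e :
  (forall N, `|b N| <= C) -> f =O_\oo e -> (fun N => b N * f N) =O_\oo e.
Proof.
move=> bC /eqO_exP[D D0 fD]; apply/eqO_exP; exists ((`|C| + 1) * D).
  by rewrite mulr_gt0 // ltr_wpDl.
apply: filterS fD => N fN; rewrite normrM -mulrA ler_pM //.
by rewrite (le_trans (bC N)) // ler_wpDr // ler_norm.
Qed.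

Lemma bigOZ c f e : f =O_\oo e -> (fun N => c * f N) =O_\oo e.
Proof. exact: (@bigO_mul_bounded `|c|). Qed.

Lemma bigO_mask (b : nat -> bool) f e : f =O_\oo e -> (fun N => (b N)%:R * f N) =O_\oo e.
Proof. by apply: (@bigO_mul_bounded 1) => N; case: (b N); rewrite ?normr1 ?normr0. Qed.

Lemma bigOB f g e : f =O_\oo e -> g =O_\oo e -> (fun N => f N - g N) =O_\oo e.
Proof. by move=> fe /oppfO ge; apply: (add2O fe); apply: ge. Qed.

Lemma bigO_sum (I : Type) (s : seq I) (P : pred I) (F : I -> nat -> R) e :
  (forall i, P i -> F i =O_\oo e) -> (fun N => \sum_(i <- s | P i) F i N) =O_\oo e.
Proof.
move=> Fe; elim: s => [|i s IH]; first by apply: eq_bigO (bigO_cst0 e) => N; rewrite big_nil.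
have [Pi|nPi] := boolP (P i).
  by apply: eq_bigO (add2O (Fe i Pi) IH) => N; rewrite big_cons Pi.
by apply: eq_bigO IH => N; rewrite big_cons (negbTE nPi).
Qed.

End SequenceBigO.

Section ErrorScale.
Variables (R : realType) (rho : R).
Hypotheses (rho_gt0 : 0 < rho) (rho_lt1 : rho < 1).
Implicit Types f : nat -> R.

(* The scale N^(r-1), except that r = 0 gives a geometric decay: it has to be
   summable, so that summation always raises the order by exactly one. *)
Definition scale r N : R := if r is r'.+1 then N.+1%:R ^+ r' else rho ^+ N.

Lemma scale_gt0 r N : 0 < scale r N.
Proof. by case: r => [|r]; rewrite exprn_gt0 // ltr0n. Qed.

Lemma scale_at0 r : scale r 0 = 1.
Proof. by case: r => [|r]; rewrite /scale ?expr0 ?expr1n. Qed.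

Lemma bigO_scaleP r f :
  f =O_\oo scale r <-> exists2 C, 0 <= C & forall N, `|f N| <= C * scale r N.
Proof. by apply: bigO_seqP; apply: scale_gt0. Qed.

Lemma scale_leS r N : scale r N <= scale r.+1 N.
Proof.
case: r => [|r] /=; first by rewrite expr0 exprn_ile1 // ltW.
by rewrite exprS ler_peMl ?exprn_ge0 // ler1n.
Qed.

Lemma bigO_scaleW r s f : (r <= s)%N -> f =O_\oo scale r -> f =O_\oo scale s.
Proof.
move=> /subnK <-; elim: (s - r)%N => // d IH /IH /bigO_scaleP[C C0 fC].
apply/bigO_scaleP; exists C => // N.
by rewrite (le_trans (fC N)) // ler_wpM2l // scale_leS.
Qed.

Lemma scale_step_le r N : scale r N.+1 <= 2 ^+ r * scale r N.
Proof.
case: r => [|r] /=; first by rewrite expr0 mul1r exprS ler_piMl ?exprn_ge0 // ltW.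
apply: (@le_trans _ _ ((2 * N.+1%:R) ^+ r)).
  by rewrite lerXn2r ?nnegrE ?mulr_ge0 // -natrM ler_nat; lia.
by rewrite exprMn ler_wpM2r ?exprn_ge0 // ler_weXn2l // ler1n.
Qed.

Lemma scale_step_ge r N : rho * scale r N <= scale r N.+1.
Proof.
case: r => [|r] /=; first by rewrite exprS.
rewrite (@le_trans _ _ (N.+1%:R ^+ r)) ?ler_piMl ?exprn_ge0 ?(ltW rho_lt1) //.
by rewrite lerXn2r ?nnegrE // ler_nat.
Qed.

Lemma bigO_scale_shift r f : (fun N => f N.+1) =O_\oo scale r <-> f =O_\oo scale r.
Proof.
split=> /bigO_scaleP[C C0 fC]; apply/bigO_scaleP.
  exists (`|f 0%N| + C / rho) => [|[|N]]; first by rewrite addr_ge0 // divr_ge0 // ltW.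
    by rewrite scale_at0 mulr1 lerDl divr_ge0 // ltW.
  apply: le_trans (fC N) _; rewrite mulrDl ler_wpDl //.
    by rewrite mulr_ge0 // ltW // scale_gt0.
  by rewrite -mulrA ler_wpM2l // ler_pdivlMl // scale_step_ge.
exists (C * 2 ^+ r) => [|N]; first by rewrite mulr_ge0 // exprn_ge0.
by rewrite (le_trans (fC _)) // -mulrA ler_wpM2l // scale_step_le.
Qed.

Lemma sum_geometric_le N : \sum_(i < N) rho ^+ i <= (1 - rho)^-1.
Proof.
have := @geometric_le_lim R N 1 rho ler01 rho_gt0; rewrite gtr0_norm // mul1r seriesEord.
by move=> /(_ rho_lt1); apply: le_trans; apply: ler_sum => i _; rewrite /= mul1r.
Qed.

Lemma sum_scale_le r N : \sum_(i < N) scale r i <= (1 - rho)^-1 * scale r.+1 N.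
Proof.
case: r => [|r]; first by rewrite /= expr0 mulr1 sum_geometric_le.
have inv_ge1 : 1 <= (1 - rho)^-1 by rewrite invf_ge1 ?subr_gt0 // gerBl ltW.
apply: (@le_trans _ _ (scale r.+2 N)); last by rewrite ler_peMl ?(ltW (scale_gt0 _ _)).
apply: (@le_trans _ _ (\sum_(i < N) N.+1%:R ^+ r)).
  by apply: ler_sum => i _ /=; rewrite lerXn2r ?nnegrE // ler_nat ltnS ltnW.
rewrite sumr_const card_ord -[_ *+ N]mulr_natl /= exprS ler_wpM2r ?exprn_ge0 //.
by rewrite ler_nat.
Qed.

Lemma bigO_scale_sum2 r f : (fun N => f N.+2 - f N) =O_\oo scale r -> f =O_\oo scale r.+1.
Proof.
move=> /bigO_scaleP[C C0 df]; pose A := `|f 0%N| + `|f 1%N|.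
have sum_ge0 N : 0 <= \sum_(i < N) scale r i.
  by rewrite sumr_ge0 // => i _; apply/ltW/scale_gt0.
have partial_sum N : `|f N| <= A + C * \sum_(i < N) scale r i /\
                     `|f N.+1| <= A + C * \sum_(i < N.+1) scale r i.
  elim: N => [|N [IH IHS]].
    split; first by rewrite big_ord0 mulr0 addr0 lerDl.
    by rewrite /A -addrA ler_wpDl // lerDl mulr_ge0.
  split=> //; have -> : f N.+2 = f N + (f N.+2 - f N) by rewrite addrC subrK.
  apply: le_trans (ler_normD _ _) _; rewrite !big_ord_recr /= !mulrDr.
  have := df N; have := mulr_ge0 C0 (ltW (scale_gt0 r N.+1)); lra.
apply/bigO_scaleP; exists (A + C * (1 - rho)^-1) => [|N].
  by rewrite addr_ge0 ?mulr_ge0 ?invr_ge0 ?subr_ge0 ?(ltW rho_lt1) // addr_ge0.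
apply: le_trans (partial_sum N).1 _.
rewrite mulrDl lerD // -?mulrA ?ler_wpM2l ?sum_scale_le //.
by rewrite ler_peMr ?addr_ge0 // exprn_ege1 // ler1n.
Qed.

Lemma bigO_scale_contract (q : R) r f :
  `|q| < rho -> (fun N => f N.+1 - q * f N) =O_\oo scale r -> f =O_\oo scale r.
Proof.
move=> q_lt /bigO_scaleP[C C0 df]; have gap_gt0 : 0 < rho - `|q| by rewrite subr_gt0.
pose B := `|f 0%N| + C / (rho - `|q|).
have B0 : 0 <= B by rewrite addr_ge0 // divr_ge0 // ltW.
have B_step : `|q| * B + C <= B * rho.
  rewrite -lerBrDl [`|q| * B]mulrC -mulrBr mulrDl divfK ?gt_eqF // lerDr.
  by rewrite mulr_ge0 // ltW.
apply/bigO_scaleP; exists B => //; elim=> [|N IH].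
  by rewrite scale_at0 mulr1 lerDl divr_ge0 // ltW.
have -> : f N.+1 = q * f N + (f N.+1 - q * f N) by rewrite addrC subrK.
apply: le_trans (_ : (`|q| * B + C) * scale r N <= _).
  by rewrite (le_trans (ler_normD _ _)) // mulrDl lerD // normrM -mulrA ler_wpM2l.
apply: le_trans (_ : B * rho * scale r N <= _).
  by rewrite ler_wpM2r // ltW // scale_gt0.
by rewrite -mulrA ler_wpM2l // scale_step_ge.
Qed.

Lemma bigO_exprn r : (fun N => N%:R ^+ r : R) =O_\oo scale r.+1.
Proof.
apply/bigO_scaleP; exists 1 => // N; rewrite mul1r ger0_norm ?exprn_ge0 //=.
by rewrite lerXn2r ?nnegrE // ler_nat.
Qed.

Lemma bigO_mul_affine (a : R) r f :
  f =O_\oo scale r.+1 -> (fun N => (N%:R + a) * f N) =O_\oo scale r.+2.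
Proof.
move=> /bigO_scaleP[C C0 fC]; apply/bigO_scaleP; exists ((1 + `|a|) * C) => [|N].
  by rewrite mulr_ge0 // addr_ge0.
rewrite normrM /= exprS mulrACA; apply: ler_pM => //.
by rewrite (le_trans (ler_normD _ _)) // normr_nat mulrDl mul1r lerD ?ler_nat // ler_peMr // ler1n.
Qed.

Lemma bigO_expansion_exprn (a : R) r :
  (fun N => (N%:R + a) ^+ r.+1 - N%:R ^+ r.+1 - r.+1%:R * a * N%:R ^+ r) =O_\oo scale r.
Proof.
case: r => [|r]; first by apply: eq_bigO (bigO_cst0 _) => N; ring.
elim: r => [|r IH].
  by apply: eq_bigO (bigOZ (a ^+ 2) (bigO_exprn 0)) => N; ring.
apply: eq_bigO (add2O (bigO_mul_affine a IH)
  (bigOZ (r.+2%:R * a ^+ 2) (bigO_exprn r.+1))) => N.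
by rewrite fctE -[r.+3%:R]natr1 !exprS; ring.
Qed.

Lemma bigO_diff_exprn r : (fun N => N.+1%:R ^+ r - N%:R ^+ r : R) =O_\oo scale r.
Proof.
case: r => [|r]; first by apply: eq_bigO (bigO_cst0 _) => N; rewrite !expr0 subrr.
apply: eq_bigO (add2O (bigO_scaleW (leqnSn r) (bigO_expansion_exprn 1 r))
  (bigOZ r.+1%:R (bigO_exprn r))) => N.
by rewrite fctE mulr1 subrK natr1.
Qed.

(* Summation turns [N ^ r] into [N ^ r.+1 / r.+1]; steps of length 2 halve it. *)
Lemma bigO_scale_sum2_exprn (a : R) r f :
  (fun N => f N.+2 - f N - a * N%:R ^+ r) =O_\oo scale r ->
  (fun N => f N - a / (2 * r.+1%:R) * N%:R ^+ r.+1) =O_\oo scale r.+1.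
Proof.
move=> df; apply: bigO_scale_sum2.
apply: eq_bigO (bigOB df (bigOZ (a / (2 * r.+1%:R)) (bigO_expansion_exprn 2 r))) => N.
have r0 : r.+1%:R != 0 :> R by rewrite pnatr_eq0.
have -> : N%:R + 2 = N.+2%:R :> R by rewrite -natrD addn2.
by field.
Qed.

Lemma scale_double r n : scale r n.*2 * n%:R <= (3 ^+ r * (1 - rho)^-1) * n%:R ^+ r.
Proof.
case: r => [|r] /=.
  rewrite !expr0 mul1r mulr1; apply: le_trans (sum_geometric_le n).
  rewrite mulr_natr -[n in _ *+ n]card_ord -sumr_const; apply: ler_sum => i _.
  by rewrite ler_wiXn2l ?(ltW rho_gt0) ?(ltW rho_lt1) //; have := ltn_ord i; lia.
case: n => [|n]; first by rewrite mulr0 expr0n mulr0.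
have inv_ge1 : 1 <= (1 - rho)^-1 by rewrite invf_ge1 ?subr_gt0 // gerBl ltW.
apply: (@le_trans _ _ ((3 * n.+1%:R) ^+ r * n.+1%:R)).
  by rewrite ler_wpM2r // lerXn2r ?nnegrE ?mulr_ge0 // -natrM ler_nat; lia.
have -> : (3 * n.+1%:R) ^+ r * n.+1%:R = 3 ^+ r * n.+1%:R ^+ r.+1 :> R.
  by rewrite exprMn -mulrA -exprSr.
rewrite ler_wpM2r ?exprn_ge0 //.
by rewrite -[leLHS]mulr1 ler_pM ?exprn_ge0 // ler_weXn2l // ler1n.
Qed.

Lemma bigO_relative_error (a : R) r f : a != 0 ->
  (fun n => f n - a * n%:R ^+ r) =O_\oo (fun n => scale r n.*2) ->
  (fun n => f n / (a * n%:R ^+ r) - 1) =O_\oo (fun n => (n%:R : R)^-1).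
Proof.
move=> a_neq0 /eqO_exP[C C0 fC]; pose D := 3 ^+ r * (1 - rho)^-1.
have D0 : 0 < D by rewrite mulr_gt0 ?exprn_gt0 // invr_gt0 subr_gt0.
apply/eqO_exP; exists (C * D / `|a|); first by rewrite divr_gt0 ?normr_gt0 // mulr_gt0.
near=> n; have n0 : 0 < n%:R :> R by rewrite ltr0n; near: n; exists 1%N.
have nr0 : 0 < n%:R ^+ r :> R by rewrite exprn_gt0.
have -> : f n / (a * n%:R ^+ r) - 1 = (f n - a * n%:R ^+ r) / (a * n%:R ^+ r).
  by field; rewrite a_neq0 gt_eqF.
rewrite normrM !normfV normrM (gtr0_norm nr0) (gtr0_norm n0).
rewrite ler_pdivrMr ?mulr_gt0 ?normr_gt0 //.
have -> : C * D / `|a| / n%:R * (`|a| * n%:R ^+ r) = C * (D * n%:R ^+ r / n%:R).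
  by field; rewrite normr_eq0 a_neq0 gt_eqF.
apply: (@le_trans _ _ (C * scale r n.*2)).
  by rewrite -[scale r n.*2]gtr0_norm ?scale_gt0 //; near: n.
by rewrite ler_wpM2l ?(ltW C0) // ler_pdivlMr // scale_double.
Unshelve. all: by end_near. Qed.

End ErrorScale.

(** * The sine transform *)

Section Trigonometry.
Variable R : realType.
Implicit Types x y : R.

Lemma sin_pi_mulrn m : sin (pi *+ m) = 0 :> R.
Proof. by have := alternatingn (@sinDpi R) m 0; rewrite add0r sin0 mulr0. Qed.

Lemma cos_pi_mulrn m : cos (pi *+ m) = (-1) ^+ m :> R.
Proof. by have := alternatingn (@cosDpi R) m 0; rewrite add0r cos0 mulr1. Qed.

Lemma sin_pi_mulrnB m x : sin (pi *+ m - x) = - (-1) ^+ m * sin x.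
Proof. by rewrite sinB sin_pi_mulrn cos_pi_mulrn mul0r sub0r mulNr. Qed.

Lemma mul_sin_sin x y : sin x * sin y = (cos (x - y) - cos (x + y)) / 2.
Proof. by rewrite cosB cosD; field. Qed.

Lemma sinDB x y : sin (x + y) + sin (x - y) = 2 * cos y * sin x.
Proof. by rewrite sinB sinD; ring. Qed.

Lemma sum_cos_mulrn x n :
  2 * sin (x / 2) * (\sum_(j < n) cos (x *+ j)) = sin (x *+ n - x / 2) + sin (x / 2).
Proof.
elim: n => [|n IH]; first by rewrite big_ord0 mulr0n sub0r sinN mulr0 addNr.
rewrite big_ord_recr /= mulrDr IH.
have -> : x *+ n.+1 - x / 2 = x *+ n + x / 2 by rewrite mulrSr; field.
by rewrite sinB sinD; ring.
Qed.

End Trigonometry.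

Section SineOrthogonality.
Variables (R : realType) (n : nat).
Let theta : R := pi / n.+1%:R.

Lemma mulrn_div_pi : theta *+ n.+1 = pi.
Proof. by rewrite /theta -[LHS]mulr_natr divfK ?pnatr_eq0. Qed.

Lemma div_pi_gt0 : 0 < theta.
Proof. by rewrite divr_gt0 ?pi_gt0 ?ltr0n. Qed.

Lemma sin_div_pi_gt0 m : (0 < m <= n)%N -> 0 < sin (theta *+ m).
Proof.
case/andP=> m0 mn; apply: sin_gt0_pi; rewrite -mulrn_div_pi.
by rewrite pmulrn_lgt0 // div_pi_gt0 ltr_pMn2l ?div_pi_gt0.
Qed.

Lemma sum_cos_div_pi m : (0 < m < n.+1.*2)%N ->
  \sum_(j < n.+1) cos (theta *+ m *+ j) = (1 - (-1) ^+ m) / 2.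
Proof.
case/andP=> m0 mn; have := sum_cos_mulrn (theta *+ m) n.+1.
rewrite -[_ *+ m *+ n.+1]mulrnAC mulrn_div_pi sin_pi_mulrnB => sumE.
have sin_gt0 : 0 < sin (theta *+ m / 2).
  apply: sin_gt0_pi; rewrite divr_gt0 ?ltr0n ?pmulrn_lgt0 ?div_pi_gt0 //=.
  by rewrite ltr_pdivrMr ?ltr0n // mulr_natr -mulrn_div_pi -mulrnA ltr_pMn2l ?div_pi_gt0 // muln2.
apply: (mulfI (lt0r_neq0 (mulr_gt0 (ltr0n R 2) sin_gt0))); rewrite sumE; by field.
Qed.

Lemma sine_orthogonal a b : (0 < a <= n)%N -> (0 < b <= n)%N ->
  \sum_(j < n.+1) sin (theta *+ (j * a)) * sin (theta *+ (j * b)) =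
  (a == b)%:R * n.+1%:R / 2.
Proof.
wlog ba : a b / (b <= a)%N.
  move=> W ha hb; case/orP: (leq_total b a) => ab; first exact: W.
  by rewrite eq_sym -W //; apply: eq_bigr => j _; rewrite mulrC.
move=> /andP[a0 an] /andP[b0 bn].
transitivity ((\sum_(j < n.+1) cos (theta *+ (a - b) *+ j)
            - \sum_(j < n.+1) cos (theta *+ (a + b) *+ j)) / 2).
  rewrite -sumrB mulr_suml; apply: eq_bigr => j _; rewrite mul_sin_sin.
  by rewrite -mulrnBr ?leq_mul2l ?ba ?orbT // -mulrnDr -mulnBr -mulnDr -!mulrnA !(mulnC j).
rewrite (sum_cos_div_pi (m := a + b)); last by lia.
have [->|a_neq_b] := eqVneq a b.
  under eq_bigr do rewrite subnn mulr0n mul0rn cos0.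
  by rewrite sumr_const card_ord addnn -mul2n exprM sqrrN !expr1n subrr mul0r subr0 mul1r.
rewrite sum_cos_div_pi; last by lia.
have -> : (-1) ^+ (a + b) = (-1) ^+ (a - b) :> R.
  by rewrite -{1}(subnK ba) -addnA addnn exprD -mul2n exprM sqrrN !expr1n mulr1.
by rewrite subrr !mul0r.
Qed.

End SineOrthogonality.

(** * Paths in a strip *)

Lemma npaths_parity K N r h : odd (N + h) -> npaths K N r h = 0%N.
Proof.
elim: N r h => [|N IH] r h /=; first by case: h => // h; rewrite andbF.
move=> oddNh; rewrite IH ?add0n; last by rewrite addnS.
case: h oddNh => // h; rewrite addnS /= negbK => oddNh.
by rewrite IH ?if_same.
Qed.

Lemma npaths_high K N r h : (K + r < h)%N -> npaths K N r h = 0%N.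
Proof.
elim: N r h => [|N IH] r [|h] //= high; first by rewrite andbF.
rewrite IH; last by lia.
case: ifP => // Cr.
have C_gt0 : (0 < 'C(h, K))%N by rewrite bin_gt0; lia.
by rewrite IH //; lia.
Qed.

Definition av132_main_term (R : realType) (k r n : nat) : R :=
  (4 * sin (pi / k.+1%:R) ^+ 2 / k.+1%:R) ^+ r.+1
  * (n%:R ^+ r / (r`!)%:R)
  * (4 * cos (pi / k.+1%:R) ^+ 2) ^+ (n - r).

Section Strip.
Variables (R : realType) (K : nat).
Let theta : R := pi / K.+2%:R.
Let wave m : R := sin (theta *+ m).

Lemma wave0 : wave 0 = 0.
Proof. by rewrite /wave mulr0n sin0. Qed.

Lemma wave_rec j h : wave (j * h.+2) + wave (j * h) = 2 * cos (theta *+ j) * wave (j * h.+1).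
Proof.
rewrite -sinDB /wave; congr (sin _ + sin _); first by rewrite -mulrnDr mulnS addnC.
by rewrite mulnS mulrnDr addrAC subrr add0r.
Qed.

Lemma wave_boundary j : wave (j * K.+2) = 0.
Proof. by rewrite /wave mulnC mulrnA mulrn_div_pi sin_pi_mulrn. Qed.

Lemma wave_reflect m : wave (K.+1 * m.+1) = (-1) ^+ m * wave m.+1.
Proof.
have -> : wave (K.+1 * m.+1) = sin (pi *+ m.+1 - theta *+ m.+1).
  congr sin; rewrite -(mulrn_div_pi R K.+1) -mulrnA -mulrnBr ?leq_pmull //.
  by rewrite [in RHS]mulSn addKn.
by rewrite sin_pi_mulrnB exprS mulN1r opprK.
Qed.

Lemma wave_last : wave K.+1 = wave 1.
Proof. by have := wave_reflect 0; rewrite muln1 expr0 mul1r. Qed.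

Lemma wave1_gt0 : 0 < wave 1.
Proof. exact: sin_div_pi_gt0. Qed.

Hypothesis K_gt0 : (0 < K)%N.

Lemma cos_theta_gt0 : 0 < cos theta.
Proof.
apply: cos_gt0_pihalf; apply/andP; split.
  by apply: lt_trans (div_pi_gt0 _ _); rewrite oppr_lt0 divr_gt0 ?pi_gt0.
by rewrite ltr_pM2l ?pi_gt0 // ltf_pV2 ?posrE ?ltr0n // ltr_nat; lia.
Qed.

Let mu : R := 2 * cos theta.

Lemma mu_gt0 : 0 < mu. Proof. by rewrite mulr_gt0 // cos_theta_gt0. Qed.

Lemma mu_neq0 : mu != 0. Proof. exact: lt0r_neq0 mu_gt0. Qed.

Let count r N h : R := (npaths K N r h)%:R / mu ^+ N.

(* The sine transform diagonalises the walk confined to heights 0 .. K. *)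
Let mode r N j : R := \sum_(h < K.+1) wave (j * h.+1) * count r N h.

Let ratio j : R := cos (theta *+ j) / cos theta.

Lemma count_step r N h : count r N.+1 h = mu^-1 * (count r N h.+1 +
  if h is i.+1 then if ('C(i, K) <= r)%N then count (r - 'C(i, K))%N N i else 0 else 0).
Proof.
rewrite /count exprS invfM mulrCA /= natrD mulrDl; congr (_ * (_ + _)).
case: h => [|i]; first by rewrite mul0r.
by case: ifP => _; rewrite ?mul0r.
Qed.

Lemma mode_step r N j :
  mode r N.+1 j = ratio j * mode r N j + wave (j * K.+1) / mu * count r N K.+1.
Proof.
pose up h : R := if h is i.+1 then count r N i else 0.
have -> : mode r N.+1 j = mu^-1 * (\sum_(h < K.+1) wave (j * h.+1) * count r N h.+1 +
                                   \sum_(h < K.+1) wave (j * h.+1) * up h).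
  rewrite -big_split mulr_sumr; apply: eq_bigr => -[[|i] iK] _ /=;
    rewrite count_step mulrCA mulrDr //.
  by rewrite bin_small // subn0.
have -> : \sum_(h < K.+1) wave (j * h.+1) * count r N h.+1 =
    \sum_(h < K.+1) wave (j * h) * count r N h + wave (j * K.+1) * count r N K.+1.
  transitivity (\sum_(h < K.+2) wave (j * h) * count r N h); last by rewrite big_ord_recr.
  by rewrite [RHS]big_ord_recl /= muln0 wave0 mul0r add0r.
have -> : \sum_(h < K.+1) wave (j * h.+1) * up h =
    \sum_(h < K.+1) wave (j * h.+2) * count r N h.
  rewrite big_ord_recl mulr0 add0r [RHS]big_ord_recr /= wave_boundary mul0r addr0.
  by apply: eq_bigr => i _.
rewrite addrAC mulrDr [mu^-1 * (wave _ * _)]mulrA [mu^-1 * wave _]mulrC; congr (_ + _).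
rewrite -big_split /mode !mulr_sumr; apply: eq_bigr => h _ /=.
rewrite -mulrDl addrC wave_rec /ratio /mu; field.
by rewrite gt_eqF // cos_theta_gt0.
Qed.

Lemma mode_inversion r N h : (h <= K)%N ->
  count r N h = 2 / K.+2%:R * \sum_(j < K.+2) wave (j * h.+1) * mode r N j.
Proof.
move=> hK; under eq_bigr do rewrite mulr_sumr.
rewrite exchange_big /=.
transitivity (2 / K.+2%:R * \sum_(i < K.+1) (i == h :> nat)%:R * K.+2%:R / 2 * count r N i).
  rewrite (bigD1 (Ordinal (hK : h < K.+1)%N)) //= eqxx big1 ?addr0.
    by rewrite mul1r; field; rewrite -(natrD _ 2) pnatr_eq0.
  by move=> i; rewrite -val_eqE /= => /negbTE->; rewrite !mul0r.
congr (_ * _); apply: eq_bigr => i _.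
under eq_bigr do rewrite mulrA.
by rewrite -mulr_suml sine_orthogonal ?ltnS //= 1?eq_sym // -ltnS ltn_ord.
Qed.

Lemma mode_last r N : mode r N K.+1 = (-1) ^+ N * mode r N 1.
Proof.
rewrite mulr_sumr; apply: eq_bigr => h _; rewrite wave_reflect mul1n.
case: (boolP (odd (N + h))) => [oddNh|].
  by rewrite /count npaths_parity // !(mulr0, mul0r).
rewrite oddD => evenNh; rewrite [RHS]mulrA -signr_odd -[(-1) ^+ N]signr_odd.
by case: (odd N) evenNh; case: (odd h).
Qed.

Lemma count_modes r N h : (h <= K)%N ->
  count r N h = 4 / K.+2%:R * wave h.+1 * ((~~ odd (N + h))%:R * mode r N 1) +
    2 / K.+2%:R * \sum_(2 <= j < K.+1) wave (j * h.+1) * mode r N j.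
Proof.
move=> hK; rewrite mode_inversion // -(big_mkord xpredT (fun j => wave (j * h.+1) * mode r N j)).
rewrite big_ltn // big_ltn // big_nat_recr //= mul0n wave0 mul0r add0r mul1n.
rewrite mode_last wave_reflect.
have -> : (~~ odd (N + h))%:R = (1 + (-1) ^+ N * (-1) ^+ h) / 2 :> R.
  rewrite -exprD -signr_odd; case: odd; first by rewrite expr1 subrr mul0r.
  by rewrite mulr1n expr0; field.
by field; rewrite -(natrD _ 2) pnatr_eq0.
Qed.

Lemma ratio1 : ratio 1 = 1.
Proof. by rewrite /ratio mulr1n divff // gt_eqF // cos_theta_gt0. Qed.

Lemma norm_ratio_lt1 j : (1 < j < K.+1)%N -> `|ratio j| < 1.
Proof.
move=> j_mid; have theta_gt0 : 0 < theta by apply: div_pi_gt0.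
rewrite normrM normfV (gtr0_norm cos_theta_gt0) ltr_pdivrMr ?cos_theta_gt0 // mul1r.
have in_pi m : (m <= K.+2)%N -> theta *+ m \in `[0, pi].
  move=> mK; rewrite in_itv /= mulrn_wge0 ?(ltW theta_gt0) //.
  by rewrite -(mulrn_div_pi R K.+1) ler_pMn2l.
rewrite ltr_norml; apply/andP; split.
  have -> : - cos theta = cos (theta *+ K.+1).
    have -> : theta *+ K.+1 = pi *+ 1 - theta.
      by rewrite mulr1n -(mulrn_div_pi R K.+1) [in RHS]mulrSr addrK.
    by rewrite cosB sin_pi_mulrn cos_pi_mulrn mul0r addr0 expr1 mulN1r.
  by rewrite ltr_cos ?in_pi ?ltr_pMn2l //; lia.
by rewrite -[ltRHS](_ : cos (theta *+ 1) = _) // ltr_cos ?in_pi ?ltr_pMn2l //; lia.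
Qed.

Lemma spectral_gap : exists rho : R,
  [/\ 0 < rho, rho < 1 & forall j, (1 < j < K.+1)%N -> `|ratio j| < rho].
Proof.
pose m := \big[Num.max/0]_(2 <= j < K.+1) `|ratio j|.
have m_ge0 : 0 <= m by apply: bigmax_ge_id.
have m_lt1 : m < 1.
  by rewrite /m big_nat; apply: bigmax_lt => // j; apply: norm_ratio_lt1.
exists ((1 + m) / 2); split; [lra|lra|move=> j j_mid].
have : `|ratio j| <= m.
  by apply: (le_bigmax_seq _ j); rewrite ?mem_index_iota.
lra.
Qed.

Let amp : R := 4 * wave 1 ^+ 2 / K.+2%:R.

Let coef r : R := wave 1 * (amp / (2 * mu ^+ 2)) ^+ r / (r`!)%:R.

Lemma coefS r : amp / mu ^+ 2 * coef r / (2 * r.+1%:R) = coef r.+1.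
Proof.
rewrite /coef factS natrM [_ ^+ r.+1]exprS.
by field; rewrite mu_neq0 pnatr_eq0 -lt0n fact_gt0 nat1r pnatr_eq0.
Qed.

Section Induction.
Variable rho : R.
Hypotheses (rho_gt0 : 0 < rho) (rho_lt1 : rho < 1).
Hypothesis ratio_lt_rho : forall j, (1 < j < K.+1)%N -> `|ratio j| < rho.

Let leading_mode r := (fun N => mode r N 1 - coef r * N%:R ^+ r) =O_\oo scale rho r.
Let damped_modes r :=
  forall j, (1 < j < K.+1)%N -> (fun N => mode r N j) =O_\oo scale rho r.
Let count_bound r := forall h, (fun N => count r N h) =O_\oo scale rho r.+1.

Lemma count_asymptotics r h : leading_mode r -> damped_modes r -> (h <= K)%N ->
  (fun N => count r N h -
    4 / K.+2%:R * wave h.+1 * ((~~ odd (N + h))%:R * (coef r * N%:R ^+ r))) =O_\oo scale rho r.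
Proof.
move=> lead damped hK.
have damped_sum : (fun N => \sum_(2 <= j < K.+1) wave (j * h.+1) * mode r N j) =O_\oo scale rho r.
  apply: eq_bigO (_ : (fun N => \sum_(2 <= j < K.+1 | (1 < j < K.+1)%N)
    wave (j * h.+1) * mode r N j) =O_\oo _) => [N|]; first by rewrite [RHS]big_nat.
  by apply: bigO_sum => j j_mid; apply/bigOZ/damped.
apply: eq_bigO (add2O (bigOZ (4 / K.+2%:R * wave h.+1)
  (bigO_mask (fun N => ~~ odd (N + h)) lead)) (bigOZ (2 / K.+2%:R) damped_sum)) => N.
by rewrite fctE count_modes //; ring.
Qed.

(* Downwards on h: heights above K + r are out of reach. *)
Lemma count_above_strip r h : (forall s, (s < r)%N -> count_bound s) -> (K <= h)%N ->
  (fun N => count r N h.+1) =O_\oo scale rho (r.+1 - 'C(h, K)).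
Proof.
move=> lower; have [d] : exists d, (K + r <= h + d)%N by exists (K + r)%N; apply: leq_addl.
elim: d h => [|d IH] h hd Kh.
  by apply: eq_bigO (bigO_cst0 _) => N; rewrite /count npaths_high ?mul0r //; lia.
apply/bigO_scale_shift => //.
have C_gt0 : (0 < 'C(h, K))%N by rewrite bin_gt0.
have lower_count : (fun N => if ('C(h, K) <= r)%N then count (r - 'C(h, K))%N N h else 0)
    =O_\oo scale rho (r.+1 - 'C(h, K)).
  by case: leqP => Cr; [rewrite subSn //; apply: lower; lia|apply: bigO_cst0].
have higher_count : (fun N => count r N h.+2) =O_\oo scale rho (r.+1 - 'C(h, K)).
  apply: bigO_scaleW (IH h.+1 _ _); rewrite ?leq_sub2l ?leq_bin2l //; lia.
apply: eq_bigO (bigOZ mu^-1 (add2O higher_count lower_count)) => N.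
by rewrite count_step.
Qed.

Lemma damped_modes_step r : (forall s, (s < r)%N -> count_bound s) -> damped_modes r.
Proof.
move=> lower j j_mid; apply: bigO_scale_contract (ratio_lt_rho j_mid) _ => //.
have := count_above_strip lower (leqnn K); rewrite binn subn1 => source.
apply: eq_bigO (bigOZ (wave (j * K.+1) / mu) source) => N.
by rewrite mode_step addrAC subrr add0r.
Qed.

Lemma count_bound_step r : leading_mode r -> damped_modes r ->
  (forall s, (s < r)%N -> count_bound s) -> count_bound r.
Proof.
move=> lead damped lower h; have [hK|] := leqP h K; last first.
  by case: h => // h Kh; apply: bigO_scaleW (count_above_strip lower Kh); rewrite ?leq_subr.
have growth : (fun N => (~~ odd (N + h))%:R * (coef r * N%:R ^+ r)) =O_\oo scale rho r.+1.
  exact/bigO_mask/bigOZ/bigO_exprn.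
apply: eq_bigO (add2O (bigO_scaleW _ _ (leqnSn r) (count_asymptotics lead damped hK))
  (bigOZ (4 / K.+2%:R * wave h.+1) growth)) => // N.
by rewrite fctE subrK.
Qed.

Lemma source_asymptotics r : leading_mode r -> damped_modes r ->
  (forall s, (s <= r)%N -> count_bound s) ->
  (fun N => count r.+1 N K.+1 - 4 / K.+2%:R * wave 1 / mu *
    ((~~ odd (N + K.+1))%:R * (coef r * N%:R ^+ r))) =O_\oo scale rho r.
Proof.
move=> lead damped lower; apply/bigO_scale_shift => //.
have above : (fun N => count r.+1 N K.+2) =O_\oo scale rho r.
  apply: bigO_scaleW (count_above_strip _ (leqnSn K)) => //.
  by rewrite binSn; lia.
have below := count_asymptotics lead damped (leqnn K).
have drift := bigO_mask (fun N => ~~ odd (N + K))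
  (bigOZ (coef r) (bigO_diff_exprn rho_gt0 rho_lt1 r)).
apply: eq_bigO (bigOB (bigOZ mu^-1 (add2O above below))
  (bigOZ (4 / K.+2%:R * wave 1 / mu) drift)) => N.
rewrite fctE count_step binn ltn0Sn subn1 wave_last addSn addnS /= negbK.
by ring.
Qed.

Lemma leading_mode_step r : leading_mode r -> damped_modes r ->
  (forall s, (s <= r)%N -> count_bound s) -> leading_mode r.+1.
Proof.
move=> lead damped lower; rewrite /leading_mode -coefS; apply: bigO_scale_sum2_exprn => //.
have source := source_asymptotics lead damped lower.
have drift := bigO_mask (fun N => ~~ odd (N.+1 + K.+1)) (bigO_diff_exprn rho_gt0 rho_lt1 r).
have shifted := (bigO_scale_shift rho_gt0 rho_lt1 _ _).2 source.
apply: eq_bigO (add2O (bigOZ (wave 1 / mu) (add2O source shifted))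
  (bigOZ (amp / mu ^+ 2 * coef r) drift)) => N.
rewrite !fctE !mode_step mul1n wave_last ratio1 /amp.
have -> : (~~ odd (N + K.+1))%:R = 1 - (~~ odd (N.+1 + K.+1))%:R :> R.
  by rewrite addSn /=; case: odd; rewrite ?subrr ?subr0.
by field; rewrite mu_neq0 -(natrD _ 2) pnatr_eq0.
Qed.

Lemma leading_mode0 : leading_mode 0.
Proof.
apply: eq_bigO (bigO_cst0 _) => N; rewrite expr0 mulr1 /coef expr0 mulr1 divr1.
elim: N => [|N IH].
  rewrite /mode big_ord_recl big1 ?addr0 ?mul1n.
    by rewrite /count /= divr1 mulr1 subrr.
  by move=> i _; rewrite /count /= mul0r mulr0.
by rewrite mode_step ratio1 mul1r /count npaths_high ?addn0 // mul0r mulr0 addr0.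
Qed.

Lemma strip_asymptotics r : [/\ leading_mode r, damped_modes r & count_bound r].
Proof.
elim/ltn_ind: r => r IH.
have lower s : (s < r)%N -> count_bound s by move=> /IH[].
have damped := damped_modes_step lower.
suff lead : leading_mode r by split=> //; apply: count_bound_step.
case: r IH lower {damped} => [|r] IH lower; first exact: leading_mode0.
by have [lead damped _] := IH r (ltnSn r); apply: leading_mode_step.
Qed.

Lemma closed_count_asymptotics r : (fun N => count r N 0 -
  4 / K.+2%:R * wave 1 * ((~~ odd (N + 0))%:R * (coef r * N%:R ^+ r))) =O_\oo scale rho r.
Proof. by have [lead damped _] := strip_asymptotics r; apply: count_asymptotics. Qed.

End Induction.

Let amplitude r : R := amp ^+ r.+1 / (r`!)%:R / mu ^+ r.*2.

Lemma amplitude_gt0 r : 0 < amplitude r.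
Proof.
have amp_gt0 : 0 < amp by rewrite divr_gt0 ?ltr0n // mulr_gt0 // exprn_gt0 // wave1_gt0.
by rewrite !divr_gt0 ?exprn_gt0 ?mu_gt0 // ltr0n fact_gt0.
Qed.

Lemma amplitudeE r n :
  4 / K.+2%:R * wave 1 * (coef r * n.*2%:R ^+ r) = amplitude r * n%:R ^+ r.
Proof.
have -> : n.*2%:R ^+ r = 2 ^+ r * n%:R ^+ r :> R by rewrite -mul2n natrM exprMn.
have mu_pow : (2 * mu ^+ 2) ^+ r = 2 ^+ r * mu ^+ r.*2 by rewrite exprMn -exprM mul2n.
rewrite /coef expr_div_n mu_pow /amplitude [_ ^+ r.+1]exprS; move: (amp ^+ r) => w.
rewrite /amp; field; rewrite !expf_neq0 ?mu_neq0 ?pnatr_eq0 //=.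
by rewrite -lt0n fact_gt0 -(natrD _ 2) pnatr_eq0.
Qed.

Lemma av132_main_termE r n : (r <= n)%N ->
  av132_main_term R K.+1 r n = amplitude r * n%:R ^+ r * mu ^+ n.*2.
Proof.
move=> rn; rewrite /av132_main_term -[sin _]/(wave 1) -/amp.
have -> : 4 * cos theta ^+ 2 = mu ^+ 2 by rewrite /mu exprMn -natrX.
rewrite -exprM mul2n doubleB -[in RHS](subnK (_ : r.*2 <= n.*2)%N) ?leq_double //.
rewrite exprD /amplitude; field.
by rewrite expf_neq0 ?mu_neq0 //= pnatr_eq0 -lt0n fact_gt0.
Qed.

Lemma npaths_asymptotics r :
  (fun n => (npaths K n.*2 r 0)%:R / av132_main_term R K.+1 r n - 1)
    =O_\oo (fun n => (n%:R : R)^-1).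
Proof.
have [rho [rho_gt0 rho_lt1 ratio_lt_rho]] := spectral_gap.
have /bigO_scaleP := closed_count_asymptotics rho_gt0 rho_lt1 ratio_lt_rho r.
case=> // C C0 countC.
have doubled : (fun n => count r n.*2 0 - amplitude r * n%:R ^+ r)
    =O_\oo (fun n => scale rho r n.*2).
  apply/bigO_seqP; first by move=> n; apply: scale_gt0.
  exists C => // n; have := countC n.*2.
  by rewrite addn0 odd_double mul1r amplitudeE.
have := bigO_relative_error rho_gt0 rho_lt1 (lt0r_neq0 (amplitude_gt0 r)) doubled.
apply: near_eq_bigO; exists r => // n /= rn.
by rewrite av132_main_termE // /count [_ * mu ^+ _]mulrC [in RHS]invfM mulrA.
Qed.

Lemma av132_main_term_neq0 r n : (0 < n)%N -> (r <= n)%N -> av132_main_term R K.+1 r n != 0.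
Proof.
move=> n_gt0 rn; rewrite av132_main_termE //; apply/lt0r_neq0/mulr_gt0.
  by apply: mulr_gt0 (amplitude_gt0 r) _; rewrite exprn_gt0 // ltr0n.
by rewrite exprn_gt0 // mu_gt0.
Qed.

End Strip.

Lemma num_av132_le1 k n r : (k <= 1)%N -> 'C(n, k) != r -> num_av132 n k r = 0%N.
Proof.
move=> k1 /negbTE binr; apply/eqP; rewrite cards_eq0; apply/eqP/setP => p.
by rewrite !inE occurrences_id_le1 // binr andbF.
Qed.

Lemma av132_main_term_le1 (R : realType) k r n :
  (k <= 1)%N -> (r < n)%N -> av132_main_term R k r n = 0.
Proof.
rewrite /av132_main_term; case: k => [|[|//]] _ rn.
  by rewrite [pi / _]divr1 sinpi expr0n mulr0 mul0r expr0n !mul0r.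
by rewrite cos_pihalf expr0n mulr0 expr0n subn_eq0 leqNgt rn mulr0.
Qed.

Theorem theorem5 (R : realType) (r k : nat)
    (hkr : ~ (k = 0%N /\ r = 1%N)) :
  exists e : nat -> R,
    e =O_\oo (fun n : nat => (n%:R : R)^-1) /\
    \forall n \near \oo,
      (num_av132 n k r)%:R =
        (4 * sin (pi / k.+1%:R) ^+ 2 / k.+1%:R) ^+ r.+1
        * (n%:R ^+ r / (r`!)%:R)
        * (4 * cos (pi / k.+1%:R) ^+ 2) ^+ (n - r)
        * (1 + e n).
Proof.
have [k1|k2] := leqP k 1.
  exists (fun=> 0); split; first exact: bigO_cst0.
  exists r.+1 => // n /= rn; rewrite -/(av132_main_term R k r n).
  rewrite av132_main_term_le1 // mul0r num_av132_le1 //.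
  case: k k1 hkr => [|[|//]] _ hkr; last by rewrite bin1 gtn_eqF.
  by rewrite bin0; apply/eqP => r1; apply: hkr.
case: k k2 {hkr} => [//|K] K_gt0.
exists (fun n => (num_av132 n K.+1 r)%:R / av132_main_term R K.+1 r n - 1); split.
  apply: eq_bigO (npaths_asymptotics R K_gt0 r) => n.
  by rewrite num_av132_npaths.
exists r.+1 => // n /= rn; rewrite -/(av132_main_term R K.+1 r n) addrC subrK mulrC divfK //.
by apply: av132_main_term_neq0 (ltnW rn); rewrite // (leq_ltn_trans _ rn).
Qed.
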